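(* Let $d\ge1$ and consider an inhomogeneous bootstrap percolation (BP) on $\mathbb Z^d$ with measure $\chi$ supported on a finite set of update families contained in the same half-space, i.e. such that there exists $u\in\mathbb R^d$ with $\langle x,u\rangle<0$ for all $\mathcal X\in\operatorname{supp}\chi$, all $X\in\mathcal X$ and all $x\in X$. Denote by $\mu_q$ the law of the i.i.d. update families with distribution $\chi$ and the i.i.d. initial condition with Bernoulli law of parameter $q$ (independent of the update families). Set $$q_{\mathrm c}=\inf\left\{q\in[0,1]:\lim_{t\to\infty}\mu_q(\eta_0(t)\neq1)=0\right\}.$$ Then for all $q\in[0,1]$ with $q>q_{\mathrm c}$ there exist $c,C>0$ such that for all integers $t>0$, $$\mu_q\left(\eta_0(t)\neq 1\right)\le Ce^{-ct}.$$
   Context: An update family is a finite family $\mathcal X$ of finite subsets of $\mathbb Z^d\setminus\{0\}$ (both the family and the sets in it may be empty). Given a finitely supported probability measure $\chi$ on update families, inhomogeneous BP is defined as follows. Each site $x\in\mathbb Z^d$ is assigned, once and for all, a random update family $\mathcal X_x$, the $\mathcal X_x$ being i.i.d. with law $\chi$. At each discrete time step, simultaneously for all sites, the state of a site $x$ becomes $1$ if it is already $1$ or there exists $X\in\mathcal X_x$ such that all elements of $x+X$ are in state $1$; otherwise the state of $x$ is $0$. The configuration at time $t$ is denoted $\eta(t)=(\eta_x(t))_{x\in\mathbb Z^d}$. By convention the initial condition is the state at time $-1$, so that $\eta(0)$ is the state after one step. *)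

(* Defs.v *)
From HB Require Import structures.
From mathcomp Require Import all_boot all_order all_algebra finmap.
From mathcomp Require Import all_classical all_reals all_analysis.

Set Implicit Arguments.
Unset Strict Implicit.
Unset Printing Implicit Defensive.

Import Order.TTheory GRing.Theory Num.Theory.
Import numFieldNormedType.Exports.

Local Open Scope classical_set_scope.
Local Open Scope ring_scope.

Definition site (d : nat) : Type := 'rV[int]_d.
HB.instance Definition _ d := GRing.Zmodule.on (site d).
HB.instance Definition _ d := Countable.on (site d).

Definition nzsite (d : nat) : Type := {x : site d | x != 0}.
HB.instance Definition _ d := Countable.on (nzsite d).

Definition update_family (d : nat) : Type := {fset {fset nzsite d}}.
HB.instance Definition _ d := Countable.on (update_family d).
HB.instance Definition _ d := isPointed.Build (update_family d) fset0.
(* The type is countable, so every subset is measurable. *)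
HB.instance Definition _ d := @isMeasurable.Build default_measure_display
  (update_family d) discrete_measurable discrete_measurable0
  discrete_measurableC discrete_measurableU.

Section Dynamics.
Variable d : nat.

(* A sample point gives each site its update family and its state at
   time -1 (true encodes the state 1). *)
Definition bp_sample : Type := site d -> update_family d * bool.

Implicit Types (w : bp_sample) (x : site d) (s : site d -> bool).

Definition bp_step w s x : bool :=
  s x || has (fun X : {fset nzsite d} =>
                all (fun y : nzsite d => s (x + val y)) X) (w x).1.

(* The initial condition sits at time -1, whence the t.+1 steps. *)
Definition eta w (t : nat) : site d -> bool :=
  iter t.+1 (bp_step w) (fun x => (w x).2).

Definition coordinate_sets : set (set bp_sample) :=
  \bigcup_(x in [set: site d])
    preimage_set_system [set: bp_sample] (fun w => w x) measurable.

Definition bp_space := g_sigma_algebraType coordinate_sets.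

Definition not_infected (t : nat) : set bp_space :=
  [set w : bp_space | eta w t 0 != true].

End Dynamics.

Arguments eta {d}.
Arguments not_infected : clear implicits.

Section Laws.
Variables (R : realType) (d : nat).
Implicit Types (chi : probability (update_family d) R).

(* Since update_family d is countable, chi is carried by this set. *)
Definition supp chi : set (update_family d) :=
  [set F | (0 < chi [set F])%E].

Definition dotprod (x : site d) (u : 'rV[R]_d) : R :=
  \sum_(i < d) (x 0 i)%:~R * u 0 i.

Definition in_common_half_space chi : Prop :=
  exists u : 'rV[R]_d, forall F : update_family d, supp chi F ->
    forall X : {fset nzsite d}, X \in F ->
    forall y : nzsite d, y \in X -> dotprod (val y) u < 0.

(* P is the law under which the update families (law chi) and the initial
   states (Bernoulli law of parameter q) of all sites are independent. The
   product rule on finite-dimensional cylinders determines P. *)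
Definition is_bp_law chi (q : R) (P : probability (bp_space d) R) : Prop :=
  forall (J : {fset site d}) (A : site d -> set (update_family d))
         (B : site d -> set bool),
    P [set w : bp_space d | forall x, x \in J -> A x (w x).1 /\ B x (w x).2] =
    (\prod_(x <- J) (chi (A x) * bernoulli_prob q (B x)))%E.

Definition q_c (mu : R -> probability (bp_space d) R) : R :=
  inf [set q : R | 0 <= q <= 1 /\
                   mu q (not_infected d t) @[t --> \oo] --> 0%E].

End Laws.

(* Main.v *)
(* The idea is to compare the model at q with the model at q0 < q conditioned on
   the infection of the origin in spite of some noise (in the spirit of
   Vanneuville's stochastic comparison for percolation).

   Let u direct the half-space and cut Z^d into slabs (levels) by depth -<x, u>,
   thick enough that no update rule jumps over one. Make every level green
   independently with a small probability h, and let xi(x) hold if the level of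
   x is green, or if x is initially healthy and every X in the family of x has a
   y with xi(x + y). If the origin survives for a time t, then surviving paths
   cross of order t levels, so xi(0) holds as soon as one of these is green.
   On the other hand, xi(x) implies that x survives for a time m or that there
   is a green level just below x; so at q0, where survival for a time m has
   vanishing probability, xi(x) has probability at most a small e, uniformly
   in x.

   Let A be the event that xi(0) fails, and reveal the sites from the shallow to
   the deep ones. By Harris' inequality, making a site x initially healthy costs
   A only a factor 1 - M with M = h + #steps * e: it suffices that xi fails at
   all x + y. Hence the conditional law given A at q0 has more healthy sites than
   the product law at q, if 1 - q <= (1 - M) (1 - q0), and
     P_q(survival) <= P_q0(survival | A) <= (1 - h)^(c t) / (1 - e),
   because survival together with A forces order t levels not to be green. *)
Require Import Defs.
From mathcomp Require Import all_boot all_order all_algebra finmap.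
From mathcomp Require Import all_classical all_reals all_analysis.
From mathcomp Require Import ring lra.
Import Order.TTheory GRing.Theory Num.Theory.
Import numFieldNormedType.Exports.
Local Open Scope classical_set_scope.
Local Open Scope ring_scope.

Set Implicit Arguments.
Unset Strict Implicit.
Unset Printing Implicit Defensive.

(** * Finite product expectations and monotone gates *)

Definition upd (I : eqType) (U : Type) (f : I -> U) (i : I) (u : U) : I -> U :=
  fun j => if j == i then u else f j.

(** With p the weight of the event [phi v], the covariance is p (1 - p) (f false - f true) (g false
    - g true). *)
Lemma bit_covariance (R : realFieldType) (T : Type) (vals : seq T) (w : T -> R)
    (phi : T -> bool) (f g : bool -> R) :
  (forall v, 0 <= w v) -> \sum_(v <- vals) w v = 1 ->
  f true <= f false -> g true <= g false ->
  (\sum_(v <- vals) w v * f (phi v)) * (\sum_(v <- vals) w v * g (phi v)) <=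
  \sum_(v <- vals) w v * (f (phi v) * g (phi v)).
Proof.
move=> w0 w1 f01 g01.
pose p := \sum_(v <- vals) w v * (phi v)%:R.
have E (k : bool -> R) : \sum_(v <- vals) w v * k (phi v) =
    p * k true + (1 - p) * k false.
  rewrite -w1 /p mulrBl !mulr_suml -sumrB -big_split /=.
  by apply: eq_bigr => v _; case: (phi v) => /=; ring.
have p0 : 0 <= p by apply: sumr_ge0 => v _; rewrite mulr_ge0.
have p1 : p <= 1.
  rewrite -w1; apply: ler_sum => v _.
  by case: (phi v); rewrite ?mulr1 // mulr0.
rewrite (E f) (E g) (E (fun b => f b * g b)) -subr_ge0.
have -> : p * (f true * g true) + (1 - p) * (f false * g false) -
  (p * f true + (1 - p) * f false) * (p * g true + (1 - p) * g false) =
  (p * (1 - p)) * ((f false - f true) * (g false - g true)) by ring.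
by rewrite !mulr_ge0 // subr_ge0.
Qed.

(* The excess weights w a - w' abar have total mass 0, and the negative ones
   sit where b is minimal. *)
Lemma reweighting (R : realFieldType) (T : eqType) (vals : seq T)
    (bad : pred T) (w w' a b : T -> R) (abar := \sum_(v <- vals) w v * a v) :
  \sum_(v <- vals) w' v = 1 ->
  (forall v, 0 <= b v) ->
  {in vals, forall v, ~~ bad v -> w' v * abar <= w v * a v} ->
  {in vals &, forall u v, bad u -> b u <= b v} ->
  (\sum_(v <- vals) w' v * b v) * abar <= \sum_(v <- vals) w v * (b v * a v).
Proof.
move=> w'1 b0 good badb.
rewrite mulr_suml.
have [/hasP [u0 u0v u0b]|/hasPn nbad] := boolP (has bad vals); last first.
  rewrite !big_seq; apply: ler_sum => v vv.
  have := good v vv (nbad v vv); have := b0 v; nra.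
rewrite -subr_ge0 -sumrB.
have tot : \sum_(v <- vals) (w v * a v - w' v * abar) = 0.
  by rewrite sumrB -mulr_suml w'1 mul1r subrr.
have -> : \sum_(v <- vals) (w v * (b v * a v) - w' v * b v * abar) =
    \sum_(v <- vals) (w v * a v - w' v * abar) * (b v - b u0).
  under [RHS]eq_bigr do rewrite mulrBr.
  rewrite [RHS]sumrB -[X in _ = _ - X]mulr_suml tot mul0r subr0.
  by apply: eq_bigr => v _; ring.
rewrite big_seq; apply: sumr_ge0 => v vv.
have [vb|vg] := boolP (bad v).
  have -> : b v = b u0 by apply/eqP; rewrite eq_le !badb.
  by rewrite subrr mulr0.
by rewrite mulr_ge0 // subr_ge0 ?good ?badb.
Qed.

Section Expectation.
Variables (R : realFieldType) (I T : eqType) (vals : seq T).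
Implicit Types (w : I -> T -> R) (s : seq I) (c : I -> T).

Definition is_law w : Prop :=
  (forall i v, 0 <= w i v) /\ (forall i, \sum_(v <- vals) w i v = 1).

Fixpoint Ex w s (F : (I -> T) -> R) c : R :=
  if s is i :: s' then \sum_(v <- vals) w i v * Ex w s' F (upd c i v) else F c.

Lemma Ex_le w s F G c : is_law w ->
  (forall c', {in s, forall i, c' i \in vals} ->
     (forall i, i \notin s -> c' i = c i) -> F c' <= G c') ->
  Ex w s F c <= Ex w s G c.
Proof.
move=> [w0 _]; elim: s c => [|i s IH] c H /=; first by apply: H.
rewrite !big_seq; apply: ler_sum => v vv; apply: ler_wpM2l => //.
apply: IH => c' c's c'n; apply: H => j; rewrite inE.
  case/predU1P => [->|/c's //].
  have [/c's //|/c'n ->] := boolP (i \in s).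
  by rewrite /upd eqxx.
by rewrite negb_or => /andP[ji /c'n ->]; rewrite /upd (negbTE ji).
Qed.

Lemma Ex_eq w s F G c : is_law w ->
  (forall c', {in s, forall i, c' i \in vals} ->
     (forall i, i \notin s -> c' i = c i) -> F c' = G c') ->
  Ex w s F c = Ex w s G c.
Proof.
by move=> wl H; apply/eqP; rewrite eq_le !Ex_le // => c' h1 h2; rewrite H.
Qed.

Lemma Ex_cst w s k c : is_law w -> Ex w s (fun=> k) c = k.
Proof.
move=> [_ w1]; elim: s c => //= i s IH c.
by under eq_bigr do rewrite IH; rewrite -mulr_suml w1 mul1r.
Qed.

Lemma ExD w s F G c :
  Ex w s (fun c' => F c' + G c') c = Ex w s F c + Ex w s G c.
Proof.
elim: s c => //= i s IH c; rewrite -big_split /=.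
by apply: eq_bigr => v _; rewrite IH mulrDr.
Qed.

Lemma ExZ w s k F c : Ex w s (fun c' => k * F c') c = k * Ex w s F c.
Proof.
elim: s c => //= i s IH c; rewrite mulr_sumr.
by apply: eq_bigr => v _; rewrite IH mulrCA.
Qed.

Lemma Ex_sum w s (J : Type) (r : seq J) (F : J -> (I -> T) -> R) c :
  is_law w ->
  Ex w s (fun c' => \sum_(j <- r) F j c') c = \sum_(j <- r) Ex w s (F j) c.
Proof.
move=> wl; elim: r => [|j r IH].
  rewrite big_nil -[RHS](@Ex_cst w s 0 c) //; apply: Ex_eq => // c' _ _.
  by rewrite big_nil.
rewrite big_cons -IH -ExD; apply: Ex_eq => // c' _ _.
by rewrite big_cons.
Qed.

Lemma Ex_cat w s1 s2 F c : Ex w (s1 ++ s2) F c = Ex w s1 (Ex w s2 F) c.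
Proof.
by elim: s1 c => //= i s IH c; apply: eq_bigr => v _; rewrite IH.
Qed.

Lemma Ex_indep w s F c : is_law w ->
  (forall c', (forall i, i \notin s -> c' i = c i) -> F c' = F c) ->
  Ex w s F c = F c.
Proof.
move=> wl H; rewrite -[RHS](@Ex_cst w s _ c) //.
by apply: Ex_eq => // c' _; apply: H.
Qed.

Lemma Ex_upd w s F c i t : i \notin s ->
  Ex w s F (upd c i t) = Ex w s (fun c' => F (upd c' i t)) c.
Proof.
elim: s c => //= j s IH c; rewrite inE negb_or => /andP[ij iNs].
apply: eq_bigr => v _; congr (_ * _); rewrite -IH //; congr (Ex w s F _).
apply/funext => k; rewrite /upd; case: eqP => // ->.
by rewrite eq_sym (negbTE ij).
Qed.

Lemma Ex_prod w s (f : I -> T -> R) c : is_law w -> uniq s ->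
  Ex w s (fun c' => \prod_(i <- s) f i (c' i)) c =
  \prod_(i <- s) \sum_(v <- vals) w i v * f i v.
Proof.
move=> wl; elim: s c => [|i s IH] c /=; first by rewrite !big_nil.
move=> /andP[iNs us]; rewrite big_cons mulr_suml.
apply: eq_bigr => v _; rewrite -mulrA; congr (_ * _).
rewrite -(IH (upd c i v) us) -ExZ; apply: Ex_eq => // c' _ c'n.
by rewrite big_cons c'n // /upd eqxx.
Qed.

Lemma Ex_coord w s (f : T -> R) i c : is_law w -> uniq s ->
  Ex w s (fun c' => f (c' i)) c =
  if i \in s then \sum_(v <- vals) w i v * f v else f (c i).
Proof.
move=> wl us; case: ifPn => [is_|iNs]; last first.
  by apply: Ex_indep => // c' ->.
transitivity
    (Ex w s (fun c' => \prod_(j <- s) (if j == i then f (c' j) else 1)) c).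
  apply: Ex_eq => // c' _ _; rewrite (bigD1_seq i) //= eqxx big1 ?mulr1 //.
  by move=> j /negbTE ->.
rewrite (Ex_prod (fun j t => if j == i then f t else 1) _ wl us).
rewrite (bigD1_seq i) //= eqxx [X in _ * X]big1 ?mulr1 // => j /negbTE ->.
by under eq_bigr do rewrite mulr1; case: wl => _ ->.
Qed.

End Expectation.

(** * Monotone gates, Harris' inequality and conditional domination *)

Section Gates.
Variables (R : realFieldType) (I T : eqType) (vals : seq T).
Variable gate : I -> T -> (I -> bool) -> bool.
Hypothesis gate_homo : forall i v (b b' : I -> bool),
  (forall j, b j -> b' j) -> gate i v b -> gate i v b'.
Implicit Types (w : I -> T -> R) (s : seq I) (c : I -> T) (b : I -> bool).
Implicit Types (F G : (I -> bool) -> R).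

(** The list is evaluated from its end: a gate sees the bits of the entries behind it, and [false]
    everywhere else. *)
Definition run s c : I -> bool :=
  foldr (fun i b => upd b i (gate i (c i) b)) (fun=> false) s.

(** The expectation of F under the law of the bits ([Dx_Ex]). Absorbing the gate of the head into
    the test function keeps inductions on [s] among functions of bits, where monotonicity makes
    sense. *)
Fixpoint Dx w s F : R :=
  if s is i :: s' then
    \sum_(v <- vals) w i v * Dx w s' (fun b => F (upd b i (gate i v b)))
  else F (fun=> false).

Lemma Dx_Ex w s F c : is_law vals w -> uniq s ->
  Dx w s F = Ex vals w s (fun c' => F (run s c')) c.
Proof.
move=> wl; elim: s F c => //= i s IH F c /andP[iNs us].
apply: eq_bigr => v _; congr (_ * _); rewrite (IH _ (upd c i v) us).
apply: Ex_eq => // c' _ /(_ i iNs) ->.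
by rewrite /upd eqxx.
Qed.

Lemma Dx_le w s F G : is_law vals w -> (forall b, F b <= G b) ->
  Dx w s F <= Dx w s G.
Proof.
move=> [w0 _]; elim: s F G => /= [|i s IH] F G FG; first exact: FG.
by apply: ler_sum => v _; apply: ler_wpM2l => //; apply: IH => b; apply: FG.
Qed.

Lemma Dx_sum w s (J : Type) (r : seq J) (k : J -> R) (F : J -> _ -> R) :
  Dx w s (fun b => \sum_(j <- r) k j * F j b) =
  \sum_(j <- r) k j * Dx w s (F j).
Proof.
elim: s F => //= i s IH F.
transitivity (\sum_(v <- vals) \sum_(j <- r)
    w i v * (k j * Dx w s (fun b => F j (upd b i (gate i v b))))).
  apply: eq_bigr => v _; rewrite -mulr_sumr; congr (_ * _).
  exact: (IH (fun j b => F j (upd b i (gate i v b)))).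
rewrite exchange_big; apply: eq_bigr => j _; rewrite mulr_sumr.
by apply: eq_bigr => v _; rewrite mulrCA.
Qed.

Definition decreasing F := forall b b', (forall i, b i -> b' i) -> F b' <= F b.

Lemma upd_homo b b' i (u u' : bool) : (forall j, b j -> b' j) -> (u -> u') ->
  forall j, upd b i u j -> upd b' i u' j.
Proof. by move=> bb' uu' j; rewrite /upd; case: ifP => // _; apply: bb'. Qed.

Lemma decreasing_gate F i v : decreasing F ->
  decreasing (fun b => F (upd b i (gate i v b))).
Proof.
by move=> dF b b' bb'; apply: dF; apply: upd_homo => //; apply: gate_homo.
Qed.

(* Each bit, given the previous ones, is one new random bit, and the
   conditional expectation of a decreasing function is again decreasing in the
   previous bits because the gates are monotone. *)
Lemma harris w s F G : is_law vals w -> decreasing F -> decreasing G ->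
  Dx w s F * Dx w s G <= Dx w s (fun b => F b * G b).
Proof.
move=> wl; elim: s F G => //= i s IH F G dF dG.
rewrite -(Dx_sum w s vals (w i) (fun v b => F (upd b i (gate i v b)))).
rewrite -(Dx_sum w s vals (w i) (fun v b => G (upd b i (gate i v b)))).
rewrite -(Dx_sum w s vals (w i)
  (fun v b => F (upd b i (gate i v b)) * G (upd b i (gate i v b)))).
have wl0 := wl.1 i.
apply: le_trans (IH _ _ _ _) _.
- by move=> b b' bb'; apply: ler_sum => v _; rewrite ler_wpM2l ?decreasing_gate.
- by move=> b b' bb'; apply: ler_sum => v _; rewrite ler_wpM2l ?decreasing_gate.
apply: Dx_le => // b.
apply: (@bit_covariance _ _ vals (w i) (fun v => gate i v b)
  (fun u => F (upd b i u)) (fun u => G (upd b i u))) => //; first exact: wl.2.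
- by apply: dF => j; apply: upd_homo.
- by apply: dG => j; apply: upd_homo.
Qed.

Lemma Dx_cst w s k : is_law vals w -> Dx w s (fun=> k) = k.
Proof.
move=> wl; elim: s => //= i s IH.
by under eq_bigr do rewrite IH; rewrite -mulr_suml wl.2 mul1r.
Qed.

Lemma DxB w s F G : Dx w s (fun b => F b - G b) = Dx w s F - Dx w s G.
Proof.
elim: s F G => //= i s IH F G; rewrite -sumrB.
by apply: eq_bigr => v _; rewrite -mulrBr -IH.
Qed.

(** Forcing the bit of i to be off can only raise F. That the gate stays closed is a decreasing
    event of probability at least 1 - M, so Harris' inequality decouples it from the forced F; on
    this event the forced and the actual bit agree. *)
Lemma gate_cost w s F i v (M : R) : is_law vals w -> decreasing F ->
  (forall b, 0 <= F b) ->
  Dx w s (fun b => (gate i v b)%:R) <= M ->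
  (1 - M) * Dx w (i :: s) F <= Dx w s (fun b => F (upd b i (gate i v b))).
Proof.
move=> wl dF F0 gM.
pose F' b := F (upd b i false).
have dF' : decreasing F' by move=> b b' bb'; apply: dF; apply: upd_homo.
have le_F' : Dx w (i :: s) F <= Dx w s F'.
  rewrite -[leRHS]mul1r -(wl.2 i) mulr_suml; apply: ler_sum => u _.
  apply: ler_wpM2l; first exact: wl.1.
  by apply: Dx_le => // b; apply: dF; apply: upd_homo.
have D0 (H : _ -> R) s' : (forall b, 0 <= H b) -> 0 <= Dx w s' H.
  by move=> H0; rewrite -(Dx_cst s' 0 wl); apply: Dx_le.
have le_gate : 1 - M <= Dx w s (fun b => 1 - (gate i v b)%:R).
  by rewrite DxB Dx_cst // lerB.
apply: (@le_trans _ _ (Dx w s (fun b => 1 - (gate i v b)%:R) * Dx w s F')).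
  apply: (@le_trans _ _ (Dx w s (fun b => 1 - (gate i v b)%:R) *
                         Dx w (i :: s) F)).
    by rewrite ler_wpM2r // D0.
  by rewrite ler_wpM2l // D0 // => b; rewrite subr_ge0 lern1 leq_b1.
apply: le_trans (harris _ wl _ dF') _.
  move=> b b' bb'; rewrite lerB // ler_nat.
  by have := gate_homo (i := i) (v := v) bb'; do 2![case: gate] => // ->.
apply: Dx_le => // b; case: (gate i v b).
  by rewrite subrr mul0r.
by rewrite subr0 mul1r.
Qed.

Lemma Ex_ge0 w s (F : (I -> T) -> R) c : is_law vals w ->
  (forall c', 0 <= F c') -> 0 <= Ex vals w s F c.
Proof.
by move=> wl F0; rewrite -(@Ex_cst _ _ _ vals w s 0 c) //; apply: Ex_le.
Qed.

(* Given that a decreasing event holds, revealing the sites of s one at a time,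
   each good value keeps conditional weight at least (1 - M) w, so the
   conditional law lies above the law w' for the increasing function B. *)
Lemma conditional_domination w w' s gs F (B : (I -> T) -> R) c
    (bad : pred T) (M : R) :
  is_law vals w -> is_law vals w' -> uniq (s ++ gs) ->
  decreasing F -> (forall b, 0 <= F b) -> (forall c, 0 <= B c) ->
  (forall c i v, i \in gs -> B (upd c i v) = B c) ->
  {in s, forall i, forall c, {in vals &, forall u v, bad u ->
     B (upd c i u) <= B (upd c i v)}} ->
  {in s, forall i, {in vals, forall v, ~~ bad v ->
     w' i v <= (1 - M) * w i v}} ->
  (forall s1 i s2, s = s1 ++ i :: s2 -> {in vals, forall v, ~~ bad v ->
     Dx w (s2 ++ gs) (fun b => (gate i v b)%:R) <= M}) ->
  Ex vals w' s B c * Dx w (s ++ gs) F <=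
  Ex vals w (s ++ gs) (fun c' => B c' * F (run (s ++ gs) c')) c.
Proof.
move=> wl wl'; elim: s F c => [|i s IH] F c us dF F0 B0 Bgs Bbad ww' gM.
  rewrite /= (Dx_Ex _ c wl us) -ExZ; apply: Ex_le => // c' _ c'n.
  (* Only coordinates of [gs] separate c' from c; they are undone one at a time, each leaving B
     unchanged. *)
  suff H (r : seq I) : {subset r <= gs} -> forall c1,
      (forall j, j \notin r -> c1 j = c j) -> B c1 = B c.
    by rewrite (H gs _ c' c'n).
  elim: r => [|i r IH] rgs c1 Hc1.
    by congr B; apply/funext => j; apply: Hc1.
  rewrite -(IH _ (upd c1 i (c i))); first by rewrite Bgs // rgs ?mem_head.
    by move=> j jr; apply: rgs; rewrite inE jr orbT.
  move=> j jr; rewrite /upd; case: eqP => [-> //|/eqP ji].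
  by apply: Hc1; rewrite inE negb_or ji.
have Bs : {in s, forall i, forall c, {in vals &, forall u v, bad u ->
     B (upd c i u) <= B (upd c i v)}}.
  by move=> j js; apply: Bbad; rewrite inE js orbT.
have ws : {in s, forall i, {in vals, forall v, ~~ bad v ->
     w' i v <= (1 - M) * w i v}}.
  by move=> j js; apply: ww'; rewrite inE js orbT.
move: us => /= /andP[iNs us].
have iNs' : i \notin s by apply: contra iNs; rewrite mem_cat => ->.
(* [a v] is the expectation of F once i has the value v. Its average under [w i] is the expectation
   of F over the whole list, so [w i v * a v] is the unnormalised conditional weight of v. *)
set a := fun v => Dx w (s ++ gs) (fun b => F (upd b i (gate i v b))).
apply: (@le_trans _ _ (\sum_(v <- vals)
    w i v * (Ex vals w' s B (upd c i v) * a v))); last first.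
  apply: ler_sum => v _; apply: ler_wpM2l; first exact: wl.1.
  have := IH (fun b => F (upd b i (gate i v b))) (upd c i v) us.
  move=> /(_ (decreasing_gate i v dF)) /(_ (fun=> F0 _) B0 Bgs Bs ws) H.
  apply: le_trans (H _) _.
    by move=> s1 j s2 E; apply: (gM (i :: s1)); rewrite E.
  apply: Ex_le => // c' _ /(_ i iNs) ->.
  by rewrite /upd eqxx.
apply: (reweighting (bad := bad)) => //.
- exact: wl'.2.
- by move=> v; apply: Ex_ge0.
- move=> v vv vg.
  have D0 : 0 <= Dx w (i :: s ++ gs) F.
    by rewrite -(Dx_cst (i :: s ++ gs) 0 wl); apply: Dx_le.
  apply: (@le_trans _ _ (((1 - M) * w i v) * Dx w (i :: s ++ gs) F)).
    by apply: ler_wpM2r => //; apply: ww'; rewrite ?mem_head.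
  rewrite mulrAC mulrC; apply: ler_wpM2l; first exact: wl.1.
  by apply: gate_cost => //; apply: (gM [::]).
- move=> u v uv vv ub.
  rewrite !Ex_upd //; apply: Ex_le => // c' _ _.
  by apply: Bbad; rewrite ?mem_head.
Qed.
End Gates.

(** * The model with green levels *)

Section Survival.
Variable d : nat.
Implicit Types (om : bp_sample d) (x y z : site d) (k : nat).
Implicit Types (F : update_family d) (S : site d -> bool).

(* Time is shifted by one: [alive k.+1] is the state 0 at time [k]. *)
Definition alive k x om : bool :=
  ~~ iter k (bp_step om) (fun z => (om z).2) x.

Definition blocked F S x : bool :=
  all (fun X : {fset nzsite d} =>
         has (fun y : nzsite d => S (x + val y)) X) F.

Lemma blockedP F S x :
  reflect (forall X : {fset nzsite d}, X \in F ->
             exists2 y : nzsite d, y \in X & S (x + val y))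
          (blocked F S x).
Proof.
apply: (iffP allP) => H X XF.
  by have /hasP[y yX Sy] := H X XF; exists y.
by have [y yX Sy] := H X XF; apply/hasP; exists y.
Qed.

Lemma blocked_homo F S S' x : (forall z, S z -> S' z) ->
  blocked F S x -> blocked F S' x.
Proof.
move=> SS' /blockedP H; apply/blockedP => X /H[y yX Sy].
by exists y => //; apply: SS'.
Qed.

Lemma alive_step k x om :
  alive k.+1 x om = alive k x om && blocked (om x).1 (alive k ^~ om) x.
Proof.
rewrite /alive iterS /bp_step negb_or; congr (_ && _).
rewrite -all_predC; apply: eq_all => X /=; rewrite -has_predC.
exact: eq_has.
Qed.

Lemma alive0 x om : alive 0 x om = ~~ (om x).2.
Proof. by []. Qed.

(** A site alive at one time is alive at all earlier times, so being blocked at the last step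
    implies being blocked before; of [alive k x] only the initial state remains to be required. *)
Lemma alive_rec k x om :
  alive k.+1 x om = ~~ (om x).2 && blocked (om x).1 (alive k ^~ om) x.
Proof.
elim: k x => [|k IH] x; rewrite alive_step // IH -andbA; congr (_ && _).
apply/andb_idl; apply: blocked_homo => z.
by rewrite alive_step => /andP[].
Qed.

Lemma alive_initial k x om : alive k x om -> (om x).2 = false.
Proof. by case: k => [|k]; rewrite ?alive_rec ?alive0; case: (om x).2. Qed.

(** An initially infected site stays infected whatever its family, so resampling it can only help
    survival. *)
Lemma alive_homo k x om om' :
  (forall z, om z = om' z \/ (om z).2) ->
  alive k x om -> alive k x om'.
Proof.
move=> H; elim: k x => [|k IH] x.
  by rewrite !alive0; case: (H x) => -> //.
rewrite !alive_rec; case: (H x) => [->|-> //] /andP[-> /=].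
exact: blocked_homo.
Qed.

Lemma alive_shift k x z om :
  alive k (x + z) om = alive k x (fun u => om (u + z)).
Proof.
elim: k x => [//|k IH] x; rewrite !alive_rec; congr (_ && _).
by apply: eq_all => X; apply: eq_has => y; rewrite addrAC IH.
Qed.

End Survival.

(* [delta] stands for the depth -<x, u>, rescaled so that one step descends by
   at least 1/speed and at most 1. *)
Record depth_structure (R : realType) (d : nat) := DepthStructure {
  fams : seq (update_family d);
  steps : seq (site d);
  delta : site d -> R;
  speed : nat;
  speed_gt0 : (0 < speed)%N;
  fams_uniq : uniq fams;
  fams_neq0 : fset0 \notin fams;
  stepsP : forall F X (y : nzsite d), F \in fams -> X \in F -> y \in X ->
    val y \in steps;
  deltaD : {morph delta : x y / x + y};
  delta_steps : {in steps, forall y, 1 <= delta y * speed%:R /\ delta y <= 1}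
}.

(** * Green levels, gates and surviving paths *)

Section Model.
Variables (R : realType) (d : nat) (D : depth_structure R d).
Notation fs := (fams D).
Notation Ns := (steps D).
Notation delta := (delta D).
Notation L := (speed D).
Notation T := (update_family d * bool)%type.
Notation I := (site d + nat)%type.
Implicit Types (x y z : site d) (k m n : nat) (c : I -> T) (b : I -> bool).

Definition level x : nat := Num.truncn (delta x).

Definition fam_vals : seq T := [seq (F, u) | F <- fs, u <- [:: true; false]].

Lemma mem_fam_vals (v : T) : (v \in fam_vals) = (v.1 \in fs).
Proof.
apply/allpairsP/idP => [[[F u] /= [Ff _ ->]] //|vf].
by exists v; case: v vf => F [].
Qed.

Lemma uniq_fam_vals : uniq fam_vals.
Proof.
apply: allpairs_uniq => //; first exact: fams_uniq.
by move=> [? ?] [? ?] _ _.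
Qed.

(* The index [inr j] carries the green bit of level j. *)
Definition bp_gate (i : I) (v : T) b : bool :=
  match i with
  | inl x => b (inr (level x)) || ~~ v.2 && blocked v.1 (fun z => b (inl z)) x
  | inr _ => v.2
  end.

Lemma bp_gate_homo i v b b' : (forall j, b j -> b' j) ->
  bp_gate i v b -> bp_gate i v b'.
Proof.
move=> bb'; case: i => [x|j] //= /orP[/bb' -> //|/andP[-> H]] /=.
by rewrite (blocked_homo _ H) ?orbT // => z; apply: bb'.
Qed.

Definition sample c : bp_sample d := fun x => c (inl x).

Lemma delta0 : delta 0 = 0.
Proof. by apply: (addrI (delta 0)); rewrite -deltaD !addr0. Qed.

Lemma step_gt0 y : y \in Ns -> 0 < delta y.
Proof.
move=> yN; have [H _] := delta_steps yN; rewrite ltNge; apply/negP => y0.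
have : delta y * L%:R <= 0 by rewrite mulr_le0_ge0 ?ler0n.
by lra.
Qed.

Lemma level_step x y : 0 <= delta x -> y \in Ns ->
  (level (x + y)%R <= (level x).+1)%N.
Proof.
move=> x0 yN; have [_ y1] := delta_steps yN; have y0 := step_gt0 yN.
have /andP[_ H] := truncn_itv x0.
rewrite /level -ltnS truncn_lt_nat deltaD; last by lra.
by rewrite -[(_.+2)%:R]natr1; lra.
Qed.

Lemma level_step_ge x y : y \in Ns -> (level x <= level (x + y)%R)%N.
Proof.
by move=> /step_gt0 y0; apply: le_truncn; rewrite deltaD; lra.
Qed.

(** The green bits stand at the end because [run] starts there: they are known to the gate of every
    site. *)
Definition indices (V : seq (site d)) n : seq I :=
  map inl V ++ map inr (iota 0 n).

Notation run := (run bp_gate).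

Lemma mem_inl (V : seq (site d)) x :
  (inl x \in map (@inl (site d) nat) V) = (x \in V).
Proof. by rewrite mem_map // => ? ? []. Qed.

Lemma mem_inlr (V : seq nat) x : (inl x \in map (@inr (site d) nat) V) = false.
Proof. by apply/negbTE/mapP => -[]. Qed.

Lemma mem_inrl (V : seq (site d)) j :
  (inr j \in map (@inl (site d) nat) V) = false.
Proof. by apply/negbTE/mapP => -[]. Qed.

Lemma mem_indices_inl V n x : (inl x \in indices V n) = (x \in V).
Proof. by rewrite mem_cat mem_inl mem_inlr orbF. Qed.

Lemma uniq_indices V n : uniq V -> uniq (indices V n).
Proof.
move=> uV; rewrite cat_uniq !map_inj_uniq ?iota_uniq ?uV /=.
- by rewrite andbT; apply/hasPn => -[x|j]; rewrite ?mem_inlr ?mem_inrl.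
- by move=> ? ? [].
- by move=> ? ? [].
Qed.

Lemma run_notin s c i : i \notin s -> run s c i = false.
Proof.
elim: s => //= j s IH; rewrite inE negb_or => /andP[ij /IH H].
by rewrite /upd (negbTE ij).
Qed.

Lemma run_level V n c j :
  run (indices V n) c (inr j) = (j < n)%N && (c (inr j)).2.
Proof.
rewrite /indices; elim: V => [|x V IH] /=; last by rewrite /upd.
rewrite -[(j < n)%N]andTb -(leq0n j) -mem_iota.
elim: (iota 0 n) => //= i s IH; rewrite inE {1}/upd.
have -> : ((inr j : I) == inr i) = (j == i) by [].
by case: eqP => [->|].
Qed.

Lemma blocked_steps F S S' x : F \in fs ->
  {in Ns, forall y, S (x + y) = S' (x + y)} -> blocked F S x = blocked F S' x.
Proof.
move=> Ff H; apply: eq_in_all => X XF; apply: eq_in_has => y yX.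
by apply: H; apply: stepsP Ff XF yX.
Qed.

(** Steps lead strictly deeper and V is sorted by depth, so the bits that the gate of x reads are
    not altered after x is evaluated; [run] thus solves the gate equations. *)
Lemma run_site V n c x : pairwise (fun x y => delta x <= delta y) V ->
  uniq V -> {in V, forall z, (c (inl z)).1 \in fs} -> x \in V ->
  run (indices V n) c (inl x) =
  bp_gate (inl x) (c (inl x)) (run (indices V n) c).
Proof.
rewrite /indices; elim: V => //= a V IH /andP[aV pV] /andP[aNV uV] cf.
set s := map inl V ++ _ in IH *.
have updE z u : {in V, forall z, delta a <= delta z} -> z \in a :: V ->
    bp_gate (inl z) (c (inl z)) (upd (run s c) (inl a) u) =
    bp_gate (inl z) (c (inl z)) (run s c).
  move=> aV' zV; rewrite /= {1}/upd /=; congr (_ || (_ && _)).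
  apply: blocked_steps; first exact: cf.
  move=> y /step_gt0 y0; rewrite /upd; case: eqP => // -[] E.
  have : delta a <= delta z.
    by move: zV; rewrite inE => /predU1P[->//|/aV'].
  by rewrite -E deltaD; lra.
have aV' : {in V, forall z, delta a <= delta z} by apply/allP.
move=> xaV; rewrite -[RHS]/(bp_gate (inl x) (c (inl x)) (upd (run s c) _ _)).
rewrite updE //; move: xaV; rewrite inE; have [->|xa /= xV] := eqVneq x a.
  by rewrite /upd eqxx.
rewrite -IH // => [|z zV]; last by apply: cf; rewrite inE zV orbT.
by rewrite /upd; case: eqP => // -[] /eqP; rewrite (negbTE xa).
Qed.

Lemma bp_gate_true x (v : T) b : bp_gate (inl x) v b -> ~~ b (inr (level x)) ->
  v.2 = false /\ blocked v.1 (fun z => b (inl z)) x.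
Proof. by move=> /= /orP[-> //|/andP[/negbTE]]. Qed.

Section Runs.
Variables (V : seq (site d)) (n : nat) (c : I -> T).
Hypothesis V_sorted : pairwise (fun x y => delta x <= delta y) V.
Hypothesis V_uniq : uniq V.
Hypothesis c_fams : {in V, forall z, (c (inl z)).1 \in fs}.
Hypothesis c_dead : forall z, z \notin V -> (c (inl z)).2.

Lemma run_alive m z : 0 <= delta z -> run (indices V n) c (inl z) ->
  (forall j, (level z <= j <= level z + m)%N -> (j < n)%N ->
     ~~ (c (inr j)).2) ->
  alive m z (sample c).
Proof.
elim: m z => [|m IH] z z0 rz nog.
all: have zV : z \in V.
1, 3: by apply: contraTT rz => zV; rewrite run_notin ?mem_indices_inl.
all: have nogz : ~~ run (indices V n) c (inr (level z)).
1, 3: rewrite run_level; apply/negP => /andP[zn].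
1, 2: by apply/negP/nog; rewrite ?leqnn ?leq_addr.
all: have := run_site n V_sorted V_uniq c_fams zV; rewrite rz => /esym.
all: move=> /bp_gate_true /(_ nogz) [c2 blk].
  by rewrite alive0 /sample c2.
rewrite alive_rec /sample c2 /=; apply/blockedP => X XF.
have /blockedP/(_ X XF)[y yX ry] := blk; exists y => //.
have yN := stepsP (c_fams zV) XF yX; have y0 := step_gt0 yN.
apply: IH => //; first by rewrite deltaD; lra.
move=> j /andP[j1 j2] jn; apply: nog => //.
rewrite (leq_trans (level_step_ge z yN) j1) (leq_trans j2) //.
by rewrite addnS -addSn leq_add2r level_step.
Qed.

(** Each step of a surviving path gains depth at least 1/L, so k steps would lead to depth j + 1; as
    no step skips a level, the path meets the green level j, and the open gate there propagates back
    up to x. *)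
Lemma alive_run k x j : 0 <= delta x -> alive k x (sample c) ->
  (level x <= j)%N -> (j < n)%N -> (c (inr j)).2 ->
  j.+1%:R * L%:R <= delta x * L%:R + k%:R ->
  run (indices V n) c (inl x).
Proof.
have L0 : 0 < L%:R :> R by rewrite ltr0n speed_gt0.
elim: k x => [|k IH] x x0 ax lx jn gj H.
  (* With no step left, the depth is already at least j + 1, which contradicts [level x <= j]. *)
  have /andP[_ Hx] := truncn_itv x0.
  have : delta x < j.+1%:R by apply: lt_le_trans Hx _; rewrite ler_nat ltnS.
  by rewrite -(ltr_pM2r L0) ltNge; move: H; rewrite addr0 => ->.
have xV : x \in V.
  by apply: contraTT ax => /c_dead xd; rewrite alive_rec /sample xd.
rewrite run_site //=.
have [lxj|lxj] := eqVneq (level x) j; first by rewrite run_level lxj jn gj.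
apply/orP; right; move: ax; rewrite alive_rec => /andP[-> /=].
move=> /blockedP blk; apply/blockedP => X XF; have [y yX ay] := blk X XF.
exists y => //; have yN := stepsP (c_fams xV) XF yX; have y0 := step_gt0 yN.
apply: IH => //.
- by rewrite deltaD; lra.
- by rewrite (leq_trans (level_step x0 yN)) // ltn_neqAle lxj.
- have [yL _] := delta_steps yN; move: H; rewrite -natr1 deltaD mulrDl; lra.
Qed.

End Runs.
(** All indices share the value type T; at a green bit the family is a dummy coordinate, weighted by
    [a] to keep total mass 1. *)
Definition weight (a : update_family d -> R) (q h : R) (i : I) (v : T) : R :=
  let p := if i is inl _ then q else h in a v.1 * (if v.2 then p else 1 - p).

(** * Probability estimates in a finite window *)

Section Weights.
Variables (a : update_family d -> R).
Hypotheses (a_ge0 : forall F, 0 <= a F) (a_sum : \sum_(F <- fs) a F = 1).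

Lemma sum_weight q h i (f : bool -> R) :
  \sum_(v <- fam_vals) weight a q h i v * f v.2 =
  let p := if i is inl _ then q else h in p * f true + (1 - p) * f false.
Proof.
rewrite /=; set r := RHS; rewrite big_allpairs -[r]mul1r -a_sum mulr_suml.
apply: eq_bigr => F _.
by rewrite !big_cons big_nil /weight /r /=; ring.
Qed.

Lemma weight_law q h : 0 <= q <= 1 -> 0 <= h <= 1 ->
  is_law fam_vals (weight a q h).
Proof.
move=> q01 h01; split=> [i v|i].
  by rewrite mulr_ge0 //; case: i => _; case: v.2; lra.
have := sum_weight q h i (fun=> 1) => /=.
by under eq_bigr do rewrite mulr1; move=> ->; ring.
Qed.

(* Outside a finite window all sites are infected, which only hinders
   survival. *)
Definition default (i : I) : T := (fset0, if i is inl _ then true else false).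

Notation Ex := (Ex fam_vals).
Notation Dx := (Dx fam_vals bp_gate).

Section Bounds.
Variables (q h : R).
Hypotheses (q01 : 0 <= q <= 1) (h01 : 0 <= h <= 1).
Let w := weight a q h.
Let wl : is_law fam_vals w := weight_law q01 h01.

Definition survival (s : seq I) m z : R :=
  Ex w s (fun c => (alive m z (sample c))%:R) default.

Lemma level_prob V n j : uniq V ->
  Ex w (indices V n) (fun c => ((j < n)%N && (c (inr j)).2)%:R) default <= h.
Proof.
move=> uV.
rewrite (Ex_coord (fun v : T => ((j < n)%N && v.2)%:R) _ _ wl) ?uniq_indices //.
have [h0 h1] := andP h01; case: ifP => _; last by rewrite andbF.
rewrite (sum_weight q h (inr j) (fun u => ((j < n)%N && u)%:R)) /=.
by case: (j < n)%N; rewrite ?mulr1 ?mulr0 ?addr0.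
Qed.

Lemma Ex_levels V n (G : (I -> T) -> R) c :
  (forall c' c'', (forall x, c' (inl x) = c'' (inl x)) -> G c' = G c'') ->
  Ex w (indices V n) G c = Ex w (map inl V) G c.
Proof.
move=> HG; rewrite Ex_cat; apply: Ex_eq => // c1 _ _.
by apply: Ex_indep => // c2 H; apply: HG => x; rewrite H ?mem_inlr.
Qed.

Lemma sample_eq (U : Type) (G : bp_sample d -> U) c' c'' :
  (forall x, c' (inl x) = c'' (inl x)) -> G (sample c') = G (sample c'').
Proof. by move=> H; congr G; apply/funext => x; apply: H. Qed.

(** A union bound over the m + 1 levels inspected by [run_alive]: either one of them is green or z
    survives. *)
Lemma site_prob V n m z : pairwise (fun x y => delta x <= delta y) V ->
  uniq V -> 0 <= delta z ->
  Dx w (indices V n) (fun b => (b (inl z))%:R) <=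
  m.+1%:R * h + survival (map inl V) m z.
Proof.
move=> sV uV z0; rewrite (Dx_Ex _ _ default wl) ?uniq_indices //.
apply: (@le_trans _ _ (Ex w (indices V n) (fun c =>
    \sum_(j <- iota (level z) m.+1) ((j < n)%N && (c (inr j)).2)%:R +
    (alive m z (sample c))%:R) default)).
  apply: Ex_le => // c cv cn.
  have [rz|] := boolP (run _ _ _); last by rewrite addr_ge0 ?sumr_ge0.
  have [/hasP[j jm gj]|/hasPn nog] :=
      boolP (has (fun j => (j < n)%N && (c (inr j)).2) (iota (level z) m.+1)).
    rewrite (bigD1_seq j) ?iota_uniq //= gj -addrA lerDl.
    by rewrite addr_ge0 ?sumr_ge0.
  rewrite (_ : alive m z (sample c) = true) ?lerDr ?sumr_ge0 //.
  apply: (run_alive (V := V) (n := n)) => //.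
  - by move=> x xV; rewrite -mem_fam_vals; apply: cv; rewrite mem_indices_inl.
  - move=> j jm jn; have := nog j; rewrite mem_iota addnS ltnS jm jn.
    by move=> /(_ isT).
rewrite ExD; apply: lerD; last first.
  rewrite Ex_levels // => c' c''.
  exact: (sample_eq (fun om => (alive m z om)%:R)).
rewrite Ex_sum //.
apply: (@le_trans _ _ (\sum_(j <- iota (level z) m.+1) h)).
  by apply: ler_sum => j _; apply: level_prob.
by rewrite big_const_seq count_predT size_iota iter_addr_0 mulr_natl.
Qed.

(** An open gate means a green level or a blocked family. The latter, being nonempty, contains a
    rule and hence a step y with an open bit at x + y; the union bound runs over all steps. *)
Lemma gate_prob V n x (v : T) e : uniq V -> v.1 \in fs -> v.2 = false ->
  {in Ns, forall y, Dx w (indices V n) (fun b => (b (inl (x + y)))%:R) <= e} ->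
  Dx w (indices V n) (fun b => (bp_gate (inl x) v b)%:R) <=
  h + (size Ns)%:R * e.
Proof.
move=> uV vf v2 He; have uT := uniq_indices n uV.
apply: (@le_trans _ _ (Dx w (indices V n)
    (fun b => (b (inr (level x)))%:R + \sum_(y <- Ns) (b (inl (x + y)))%:R))).
  apply: Dx_le => // b; case: (boolP (bp_gate _ _ _)); last first.
    by rewrite addr_ge0 ?sumr_ge0.
  case: (boolP (b (inr (level x)))) => [_ _|nb /bp_gate_true /(_ nb)[_]].
    by rewrite lerDl sumr_ge0.
  move=> /blockedP blk.
  have [X XF] : exists X, X \in v.1.
    by apply/fset0Pn; apply: contraNneq (fams_neq0 D) => <-.
  have [y yX yb] := blk X XF; have yN := stepsP vf XF yX.
  rewrite add0r; elim: Ns yN => // y' r IH; rewrite inE big_cons.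
  move=> /predU1P[<-|/IH H]; first by rewrite yb lerDl sumr_ge0.
  by apply: (le_trans H); rewrite lerDr.
rewrite (Dx_Ex _ _ default wl uT) ExD Ex_sum //; apply: lerD.
  under [X in Ex _ _ X]funext do rewrite run_level.
  exact: level_prob.
apply: (@le_trans _ _ (\sum_(y <- Ns) e)).
  by rewrite !big_seq; apply: ler_sum => y /He; rewrite (Dx_Ex _ _ default wl).
by rewrite big_const_seq count_predT iter_addr_0 mulr_natl.
Qed.

End Bounds.

(** At [q0], the survival bound [e - m.+1 * h] gives every site bit probability at most [e]
    ([site_prob]) and every gate of a healthy site at most [M] ([gate_prob]). The condition
    [n * L <= k] makes survival up to [k] cross n levels. *)
Lemma survival_decay V n k m (q0 q h e M : R) :
  pairwise (fun x y => delta x <= delta y) V -> uniq V ->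
  {in V, forall x, 0 <= delta x} ->
  0 <= q0 <= 1 -> 0 <= q <= 1 -> 0 <= h <= 1 ->
  (forall V' z, uniq V' -> survival q0 h (map inl V') m z <= e - m.+1%:R * h) ->
  h + (size Ns)%:R * e <= M -> 1 - q <= (1 - M) * (1 - q0) ->
  (n * L <= k)%N ->
  survival q h (map inl V) k 0 * (1 - e) <= (1 - h) ^+ n.
Proof.
move=> sV uV V0 q001 q01 h01 He HM qM nk.
have wl := weight_law q001 h01; have wl' := weight_law q01 h01.
set w := weight a q0 h in wl; set w' := weight a q h in wl'.
have site_e V' z : pairwise (fun x y => delta x <= delta y) V' -> uniq V' ->
    0 <= delta z -> Dx w (indices V' n) (fun b => (b (inl z))%:R) <= e.
  move=> sV' uV' z0; apply: le_trans (site_prob q001 h01 n m sV' uV' z0) _.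
  by have := He V' z uV'; lra.
(* The indicator of the conditioning event: the bit of the origin is off. *)
pose Fn (b : I -> bool) : R := 1 - (b (inl 0))%:R.
have FnE : 1 - e <= Dx w (indices V n) Fn.
  by rewrite DxB Dx_cst // lerB // site_e // delta0.
apply: (@le_trans _ _ (survival q h (map inl V) k 0 * Dx w (indices V n) Fn)).
  by rewrite ler_wpM2l // Ex_ge0.
apply: le_trans (@conditional_domination _ _ _ fam_vals bp_gate
  bp_gate_homo w w' (map inl V) (map inr (iota 0 n)) Fn
  (fun c => (alive k 0 (sample c))%:R) default (fun v => v.2) M
  wl wl' (uniq_indices n uV) _ _ _ _ _ _ _) _.
- move=> b b' bb'; rewrite lerB // ler_nat.
  by move: (bb' (inl 0)); case: (b _) => // ->.
- by move=> b; rewrite subr_ge0 lern1 leq_b1.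
- by [].
- move=> c [x|j]; first by rewrite mem_inlr.
  move=> v _; apply: (sample_eq (fun om => (alive k 0 om)%:R)) => x.
  by rewrite /upd.
- move=> i /mapP[x xV ->] c u v _ _ u2; rewrite ler_nat.
  suff : alive k 0 (sample (upd c (inl x) u)) ->
    alive k 0 (sample (upd c (inl x) v)) by case: alive => // ->.
  apply: alive_homo => z; rewrite /sample /upd; case: eqP => _; last by left.
  by right.
(* For a healthy value the family weight cancels, leaving 1 - q <= (1 - M) (1 - q0). *)
- move=> i /mapP[x xV ->] v _ /negbTE v2; rewrite /w /w' /weight v2.
  by rewrite mulrCA ler_wpM2l.
- move=> s1 i s2 E v; rewrite mem_fam_vals => vf /negbTE v2.
  (* The sites still to be revealed after x form a tail V2 of V, again sorted; this is why [site_e]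
     is stated for every sorted window. *)
  have [V1 [V2 [EV E2]]] : exists V1 V2, V = V1 ++ V2 /\ i :: s2 = map inl V2.
    exists (take (size s1) V), (drop (size s1) V); rewrite cat_take_drop.
    by rewrite map_drop E drop_size_cat.
  case: V2 EV E2 => // x V2 EV [-> ->].
  move: sV uV V0; rewrite EV pairwise_cat cat_uniq.
  move=> /and3P[_ _ /= /andP[_ sV2]].
  move=> /and3P[_ _ /= /andP[_ uV2]] V0.
  apply: le_trans HM; apply: (gate_prob q001 h01 uV2 vf v2) => y /step_gt0 y0.
  apply: site_e => //; rewrite deltaD.
  by have := V0 x; rewrite mem_cat mem_head orbT => /(_ isT); lra.
rewrite -/(indices V n).
(* If the origin survives, a green level j < n would switch its bit on by [alive_run]; the
   conditioning event therefore leaves all n levels without green. *)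
apply: (@le_trans _ _ (Ex w (indices V n)
  (fun c => \prod_(i <- map inr (iota 0 n)) (~~ (c i).2)%:R) default)).
  apply: Ex_le => // c cv cn.
  have [ak|_] := boolP (alive k 0 (sample c)); last first.
    by rewrite mul0r prodr_ge0.
  rewrite mul1r big_map /Fn.
  have [/hasP[j]|/hasPn nog] := boolP (has (fun j => (c (inr j)).2) (iota 0 n)).
    rewrite mem_iota => /andP[_ jn] gj.
    rewrite (_ : run _ _ _ = true) ?subrr ?prodr_ge0 //.
    apply: (@alive_run V n c _ _ _ _ k 0 j) => //.
    + by move=> x xV; rewrite -mem_fam_vals; apply: cv; rewrite mem_indices_inl.
    + by move=> x xV; rewrite cn ?mem_indices_inl.
    + by rewrite delta0.
    + by rewrite /level delta0 truncn0.
    + rewrite delta0 mul0r add0r -natrM ler_nat.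
      by apply: leq_trans nk; rewrite leq_mul2r jn orbT.
  rewrite big_seq big1 ?lerBlDl ?lerDr // => j /nog.
  by case: (c _).2.
rewrite Ex_cat.
have H c : Ex w (map inr (iota 0 n))
    (fun c => \prod_(i <- map inr (iota 0 n)) (~~ (c i).2)%:R) c = (1 - h) ^+ n.
  rewrite (Ex_prod (fun _ v => (~~ v.2)%:R)) //; last first.
    by rewrite map_inj_uniq ?iota_uniq // => ? ? [].
  rewrite big_map (eq_bigr (fun=> 1 - h)).
    by rewrite big_const_seq count_predT size_iota iter_mulr_1.
  move=> j _; rewrite (sum_weight q0 h (inr j) (fun u => (~~ u)%:R)) /=.
  by rewrite mulr0 add0r mulr1.
by rewrite (Ex_eq (G := fun=> (1 - h) ^+ n)) ?Ex_cst.
Qed.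

End Weights.
End Model.

(** * The law of the process on finite windows *)

Section Measurability.
Variable d : nat.
Notation T := (update_family d * bool)%type.
Implicit Types (x z : site d).

Lemma measurable_site x (S : set T) :
  measurable [set om : bp_space d | S (om x)].
Proof.
apply: sub_sigma_algebra; exists x => //; exists S; last by rewrite setTI.
apply: countable_measurable => [[F u]|]; last exact: countableP.
rewrite (_ : [set (F, u)] = [set F] `*` [set u]); first exact: measurableX.
by apply/seteqP; split => [? -> //|[? ?] [/= -> ->]].
Qed.

(** Splitting by the family at z, among countably many, fixes the finite sets over which the rules
    and their elements range. *)
Lemma measurable_alive k z : measurable [set om : bp_space d | alive k z om].
Proof.
elim: k z => [|k IH] z.
  exact: (measurable_site z [set v | ~~ v.2]).
rewrite (_ : [set _ | _] = [set om : bp_space d | ~~ (om z).2] `&`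
  \bigcup_(F : update_family d) ([set om : bp_space d | (om z).1 = F] `&`
     \bigcap_(X in [set` F]) \bigcup_(y in [set` X])
       [set om : bp_space d | alive k (z + val y) om])); last first.
  apply/seteqP; split => [om /=|om [] /= nz [F _ [/= <- H]]].
    rewrite alive_rec => /andP[nz /blockedP H]; split=> //.
    by exists (om z).1.
  rewrite alive_rec nz; apply/blockedP => X XF.
  by have [y yX ay] := H X XF; exists y.
apply: measurableI; first exact: (measurable_site z [set v | ~~ v.2]).
apply: countable_bigcupT_measurable => // F; apply: measurableI.
  exact: (measurable_site z [set v | v.1 = F]).
apply: fin_bigcap_measurable => // X _.
by apply: fin_bigcup_measurable => // y _.
Qed.

End Measurability.

Section Law.
Variables (R : realType) (d : nat) (D : depth_structure R d).
Variables (chi : probability (update_family d) R) (q : R).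
Variable P : probability (bp_space d) R.
Notation fs := (fams D).
Notation Ns := (steps D).
Notation T := (update_family d * bool)%type.
Notation I := (site d + nat)%type.
Notation vals := (fam_vals D).
Hypothesis chi_fams : chi (~` [set` fs]) = 0%E.
Hypothesis q01 : 0 <= q <= 1.
Hypothesis P_law : is_bp_law chi q P.
Implicit Types (x z : site d) (c : I -> T) (V : seq (site d)).

Definition mass (F : update_family d) : R := fine (chi [set F]).

Lemma mass_ge0 F : 0 <= mass F.
Proof. exact: fine_ge0. Qed.

Lemma mass_sum : \sum_(F <- fs) mass F = 1.
Proof.
apply: EFin_inj; rewrite -(probability_setT chi).
rewrite -(setUv [set` fs]) measureU0 //.
have -> : [set` fs] = \bigcup_(F in [set` fs]) [set F].
  by apply/seteqP; split => [F Ff|F [G Gf ->] //]; exists F.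
rewrite measure_fin_bigcup //; last first.
  by move=> F G _ _ [? [-> ->]].
  exact: finite_seq.
rewrite -sumEFin fsbig_seq ?fams_uniq //; apply: eq_fsbigr => F _.
by rewrite fineK // fin_num_measure.
Qed.

Local Notation w := (fun h => weight mass q h).

Lemma family_in_fams x : P [set om : bp_space d | (om x).1 \notin fs] = 0%E.
Proof.
have := P_law [fset x]%fset (fun=> ~` [set` fs]) (fun=> setT).
rewrite big_seq_fset1 chi_fams mul0e => <-; congr (P _).
apply/seteqP; split => [om /= nf y|om /= H].
  by rewrite inE => /eqP ->; split=> //; apply/negP.
by apply/negP; case: (H x); rewrite ?inE.
Qed.

(** Values outside [vals] have a family outside [fams D], which is a null event. *)
Lemma measure_by_value x (S : set (bp_space d)) : measurable S ->
  P S = (\sum_(v <- vals) P (S `&` [set om | om x = v]))%E.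
Proof.
move=> mS.
have mv (l : seq T) : measurable [set om : bp_space d | om x \in l].
  exact: (measurable_site x [set v | v \in l]).
have H (l : seq T) : uniq l -> P (S `&` [set om | om x \in l]) =
    (\sum_(v <- l) P (S `&` [set om | om x = v]))%E.
  elim: l => [|v l IH].
    rewrite big_nil (_ : _ `&` _ = set0) ?measure0 //.
    by rewrite predeqE => om; split=> // -[].
  move=> /= /andP[vl ul]; rewrite big_cons -IH // -measureU.
  - congr (P _); rewrite -setIUr; congr (_ `&` _).
    apply/seteqP; split => om /=; rewrite inE.
      by move=> /predU1P[]; [left|right].
    by case=> ->; rewrite ?eqxx ?orbT.
  - apply: measurableI => //; exact: (measurable_site x [set u | u = v]).
  - exact: measurableI.
  - rewrite predeqE => om; split => // -[[_ /= ->] [_ /=]].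
    by rewrite (negbTE vl).
rewrite -H ?uniq_fam_vals // (measureDI P mS (mv vals)).
rewrite [X in (X + _)%E](_ : _ = 0%E) ?add0e //.
apply: subset_measure0 (family_in_fams x).
- exact: measurableD.
- exact: (measurable_site x [set v | v.1 \notin fs]).
- by move=> om [_ /=]; rewrite mem_fam_vals => /negP.
Qed.

Definition cylinder (J : {fset site d}) (A : site d -> set (update_family d))
    (B : site d -> set bool) : set (bp_space d) :=
  [set om | forall x, x \in J -> A x (om x).1 /\ B x (om x).2].

Lemma measurable_cylinder J A B : measurable (cylinder J A B).
Proof.
rewrite (_ : cylinder J A B =
    \bigcap_(x in [set` J]) [set om | A x (om x).1 /\ B x (om x).2]) //.
apply: fin_bigcap_measurable => // x _.
exact: (measurable_site x [set v | A x v.1 /\ B x v.2]).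
Qed.

Lemma cylinder_cons J A B x (v : T) : x \notin J ->
  cylinder J A B `&` [set om | om x = v] =
  cylinder (x |` J)%fset (upd A x [set v.1]) (upd B x [set v.2]).
Proof.
move=> xJ.
have upd_J U (f : site d -> U) u y : y \in J -> upd f x u y = f y.
  by rewrite /upd; case: eqP => // ->; rewrite (negbTE xJ).
apply/seteqP; split => [om [/= H omx] y|om H].
  rewrite in_fset1U => /predU1P[->|yJ]; last by rewrite !upd_J //; apply: H.
  by rewrite /upd eqxx omx.
split=> /= [y yJ|].
  by have := H y; rewrite in_fset1U yJ orbT !upd_J // => /(_ isT).
have := H x; rewrite in_fset1U eqxx /upd eqxx => /(_ isT) [].
by case: (om x) (v) => ? ? [? ?] /= -> ->.
Qed.

Lemma cylinder_value h J A B x (v : T) : x \notin J ->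
  P (cylinder J A B `&` [set om | om x = v]) =
  (P (cylinder J A B) * (w h (inl x) v)%:E)%E.
Proof.
move=> xJ; rewrite cylinder_cons //.
rewrite [LHS]P_law [P (cylinder _ _ _)]P_law big_fsetU1 //= muleC.
congr (_ * _)%E.
  rewrite !big_seq; apply: eq_bigr => y yJ.
  by rewrite /upd; case: eqP yJ => // ->; rewrite (negbTE xJ).
rewrite /upd eqxx /weight EFinM fineK ?fin_num_measure //; congr (_ * _)%E.
rewrite bernoulli_probE //= !diracE.
by case: v.2; rewrite !in_set1 /= ?mule0 ?mule1 ?adde0 ?add0e.
Qed.

(** A fold of updates, so that it unfolds in step with the recursion of [Ex]. *)
Definition overwrite V (om : bp_sample d) c : I -> T :=
  foldl (fun c x => upd c (inl x) (om x)) c V.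

Lemma overwriteE V om c x :
  overwrite V om c (inl x) = if x \in V then om x else c (inl x).
Proof.
elim: V c => //= y V IH c; rewrite IH inE /upd; case: ifP => [|_].
  by rewrite orbT.
rewrite orbF; have [->|xy] := eqVneq x y; rewrite ?eqxx //.
by case: eqP => // -[] /eqP; rewrite (negbTE xy).
Qed.

Lemma measurable_overwrite V (G : (I -> T) -> bool) c :
  measurable [set om : bp_space d | G (overwrite V om c)].
Proof.
elim: V c => [|x V IH] c.
  rewrite /overwrite /=; case: (G c).
    by rewrite (_ : [set _ | _] = setT) // predeqE.
  by rewrite (_ : [set _ | _] = set0) // predeqE.
rewrite (_ : [set _ | _] = \bigcup_(v : T) ([set om | om x = v] `&`
    [set om | G (overwrite V om (upd c (inl x) v))])); last first.
  by apply/seteqP; split => [om /= H|om [v _ [/= <-]] //]; exists (om x).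
apply: countable_bigcupT_measurable => [|v]; first exact: countableP.
by apply: measurableI => //; apply: (measurable_site x [set u | u = v]).
Qed.

(** The cylinder over J carries the values revealed so far: fixing the value at x extends it to x
    and multiplies its probability by the weight of that value. *)
Lemma prob_overwrite h V J A B (G : (I -> T) -> bool) c :
  uniq V -> {in V, forall x, x \notin J} ->
  P (cylinder J A B `&` [set om | G (overwrite V om c)]) =
  (P (cylinder J A B) *
   (Ex vals (w h) (map inl V) (fun c' => (G c')%:R) c)%:E)%E.
Proof.
elim: V J A B c => [|x V IH] J A B c /=.
  move=> _ _; case: (G c).
    by rewrite mule1 (_ : [set _ | _] = setT) ?setIT // predeqE.
  by rewrite mule0 (_ : [set _ | _] = set0) ?setI0 ?measure0 // predeqE.
move=> /andP[xV uV] VJ.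
have xJ : x \notin J by rewrite VJ ?mem_head.
rewrite (measure_by_value x); last first.
  apply: measurableI; first exact: measurable_cylinder.
  exact: (measurable_overwrite (x :: V)).
have PJ : P (cylinder J A B) \is a fin_num.
  by rewrite fin_num_measure //; apply: measurable_cylinder.
rewrite -(fineK PJ) -EFinM mulr_sumr -sumEFin; apply: eq_bigr => v _.
rewrite mulrA EFinM [in RHS]EFinM fineK // -(cylinder_value h A B v xJ).
rewrite cylinder_cons // -IH //; last first.
  move=> y yV; rewrite in_fset1U negb_or VJ ?inE ?yV ?orbT // andbT.
  by apply: contraNneq xV => <-.
rewrite -cylinder_cons //; congr (P _).
by apply/seteqP; split => om /= [[H1 H2] H3]; [rewrite -H3|rewrite H2].
Qed.

Lemma prob_overwrite_all h V (G : (I -> T) -> bool) c : uniq V ->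
  P [set om | G (overwrite V om c)] =
  (Ex vals (w h) (map inl V) (fun c' => (G c')%:R) c)%:E.
Proof.
move=> uV.
have cT : cylinder fset0 (fun=> setT) (fun=> setT) = setT.
  by rewrite predeqE => om; split => // _ x; rewrite inE.
have := @prob_overwrite h V fset0 (fun=> setT) (fun=> setT) G c uV.
rewrite cT setTI probability_setT mul1e; apply.
by move=> x _; rewrite inE.
Qed.

Lemma survival_le h V k z : uniq V ->
  ((survival D mass q h (map inl V) k z)%:E <=
   P [set om : bp_space d | alive k z om])%E.
Proof.
move=> uV.
rewrite -(@prob_overwrite_all h V (fun c => alive k z (sample c))) //.
rewrite le_measure ?inE //.
- exact: (measurable_overwrite V (fun c => alive k z (sample c))).
- exact: measurable_alive.
- move=> om /=; apply: alive_homo => x; rewrite /sample overwriteE.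
  by case: ifP => _; [left|right].
Qed.

Fixpoint reach k z : seq (site d) :=
  z :: if k is k'.+1 then flatten [seq reach k' (z + y) | y <- Ns] else [::].

Lemma alive_local k z om om' :
  {in reach k z, forall x, om x = om' x /\ (om x).1 \in fs} ->
  alive k z om = alive k z om'.
Proof.
elim: k z => [|k IH] z H.
  by rewrite !alive0; have [|->] := H z; rewrite ?mem_head.
rewrite !alive_rec; have [|<- zf] := H z; rewrite ?mem_head //.
congr (_ && _); apply: blocked_steps zf _ => y yN; apply: IH => x xb.
apply: H; rewrite inE; apply/orP; right; apply/flattenP.
by exists (reach k (z + y)) => //; apply: map_f.
Qed.

Lemma survival_reach h V k z : uniq V -> {subset reach k z <= V} ->
  (survival D mass q h (map inl V) k z)%:E =
  P [set om : bp_space d | alive k z om].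
Proof.
move=> uV bV.
rewrite -(@prob_overwrite_all h V (fun c => alive k z (sample c))) //.
(* Off the null event N all families in V lie in [fams D], so [alive_local] applies and overwriting
   by V changes nothing for z. *)
pose N := [set om : bp_space d | ~~ all (fun x => (om x).1 \in fs) V].
have [mN PN] : measurable N /\ P N = 0%E.
  rewrite {}/N; elim: V {uV bV} => [|x V [mN PN]].
    by rewrite (_ : [set _ | _] = set0) ?measure0 // predeqE.
  rewrite (_ : [set _ | _] = [set om : bp_space d | (om x).1 \notin fs] `|`
     [set om | ~~ all (fun x => (om x).1 \in fs) V]); last first.
    by apply/seteqP; split => om /=; rewrite negb_and => /orP.
  have mx : measurable [set om : bp_space d | (om x).1 \notin fs].
    exact: (measurable_site x [set v | v.1 \notin fs]).
  split; first exact: measurableU.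
  by rewrite measureU0 ?PN; first exact: family_in_fams.
have mA : measurable [set om : bp_space d | alive k z om].
  exact: measurable_alive.
have mB := measurable_overwrite V (fun c => alive k z (sample c)) (@default d).
have AB om : ~ N om ->
    alive k z (sample (overwrite V om (@default d))) = alive k z om.
  move=> /negP; rewrite negbK => /allP H; symmetry; apply: alive_local.
  by move=> x /bV xV; rewrite /sample overwriteE xV; split=> //; apply: H.
rewrite -(measureU0 mB mN PN) -(measureU0 mA mN PN); congr (P _).
apply/seteqP; split => om; have [Nom|/AB E] := pselect (N om); try by right.
  by case=> [/= H|]; [left; rewrite /= -E|right].
by case=> [/= H|]; [left; rewrite /= E|right].
Qed.

Lemma reach_shift k x z : reach k (x + z) = [seq y + z | y <- reach k x].
Proof.
elim: k x => //= k IH x; congr (_ :: _).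
rewrite map_flatten -map_comp; congr flatten; apply: eq_map => y /=.
by rewrite addrAC IH.
Qed.

Lemma survival_shift h V k z :
  survival D mass q h (map inl [seq x + z | x <- V]) k z =
  survival D mass q h (map inl V) k 0.
Proof.
rewrite /survival.
suff H c c' : (forall x, c (inl (x + z)) = c' (inl x)) ->
    Ex vals (w h) (map inl [seq x + z | x <- V])
      (fun c => (alive k z (sample c))%:R) c =
    Ex vals (w h) (map inl V) (fun c => (alive k 0 (sample c))%:R) c'.
  by apply: H.
elim: V c c' => [|x V IH] c c' H /=.
  rewrite -[z in LHS]add0r alive_shift; congr (nat_of_bool (alive k 0 _))%:R.
  by apply/funext => x; apply: H.
apply: eq_bigr => v _; congr (_ * _); apply: IH => y.
rewrite /upd (_ : ((inl (y + z) : I) == inl (x + z)) = (y + z == x + z)) //.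
by rewrite (inj_eq (addIr z)) H.
Qed.

(** Translation invariance is read off from finite windows: [reach] and the window translate
    together, and the weights are the same at all sites. *)
Lemma alive_invariant k z : P [set om : bp_space d | alive k z om] =
  P [set om : bp_space d | alive k 0 om].
Proof.
pose V := undup (reach k 0).
have uV : uniq V by apply: undup_uniq.
rewrite -(@survival_reach 0 V k 0) //; last by move=> x; rewrite mem_undup.
rewrite -(survival_shift 0 V k z) survival_reach //.
  by rewrite map_inj_uniq //; apply: addIr.
move=> x; rewrite -[z in reach _ z]add0r reach_shift => /mapP[y yb ->].
by apply: map_f; rewrite mem_undup.
Qed.

End Law.

(** * Exponential decay *)

Lemma not_infectedE d t :
  not_infected d t = [set om : bp_space d | alive t.+1 0 om].
Proof. by apply/seteqP; split => om; rewrite /not_infected /= eqb_id. Qed.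

Section Consequences.
Variables (R : realType) (d : nat) (chi : probability (update_family d) R).

(** The complement of the support is a countable union of null singletons, enumerated by
    [pickle]. *)
Lemma supp_compl : chi (~` supp chi) = 0%E.
Proof.
apply/negligibleP => //.
apply: (@negligibleS _ _ _ _ (\bigcup_n
   [set F : update_family d | ~ supp chi F /\ choice.pickle F = n])).
  by move=> F nF; exists (choice.pickle F).
apply: negligible_bigcup => n.
have [[F [nF Fn]]|nF] := pselect (exists F : update_family d,
    ~ supp chi F /\ choice.pickle F = n).
  exists [set F]; split => //; last first.
    move=> G [_ Gn] /=; apply: (pcan_inj choice.pickleK).
    by rewrite Gn Fn.
  by apply/eqP; rewrite -measure_le0 leNgt; apply/negP.
by apply: negligibleS (negligible_set0 _) => F HF; apply: nF; exists F.
Qed.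

Lemma le_sum_seq (r : seq (site d)) (f : site d -> R) y :
  {in r, forall x, 0 <= f x} -> y \in r -> f y <= \sum_(x <- r) f x.
Proof.
elim: r => // x r IH f0; rewrite inE big_cons => /predU1P[->|yr].
  rewrite lerDl big_seq sumr_ge0 // => z zr.
  by apply: f0; rewrite inE zr orbT.
apply: le_trans (IH _ yr) _ => [z zr|]; first by apply: f0; rewrite inE zr orbT.
by rewrite lerDr f0 ?mem_head.
Qed.

Lemma depth_structure_exists : finite_set (supp chi) ->
  in_common_half_space chi -> chi [set fset0] = 0%E ->
  exists D : depth_structure R d, chi (~` [set` fams D]) = 0%E.
Proof.
move=> /finite_seqP[s0 suppE] [u Hu] chi0.
pose fs := undup s0.
have fsE F : (F \in fs) <-> supp chi F.
  by rewrite suppE /= mem_undup.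
pose Ns := flatten [seq flatten [seq [seq val y | y : nzsite d <- X] |
  X : {fset nzsite d} <- F] | F : update_family d <- fs].
have NsP F (X : {fset nzsite d}) (y : nzsite d) :
    F \in fs -> X \in F -> y \in X -> val y \in Ns.
  move=> Ff XF yX; apply/flattenP; eexists; first exact: (map_f _ Ff).
  apply/flattenP; eexists; first exact: (map_f _ XF).
  exact: map_f.
pose f (x : site d) : R := - dotprod x u.
have fN : {in Ns, forall y, 0 < f y}.
  move=> z /flattenP[r /mapP[F Ff ->] /flattenP[r' /mapP[X XF ->]]].
  move=> /mapP[y yX ->]; rewrite /f oppr_gt0.
  by apply: Hu XF _ yX; apply/fsE.
have fD : {morph f : x y / x + y}.
  move=> x y; rewrite /f /dotprod -opprD -big_split /=; congr (- _).
  by apply: eq_bigr => i _; rewrite mxE intrD mulrDl.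
(* Dividing by b makes every step descend by at most 1; the summand 1 keeps b positive even when
   there are no steps. *)
pose b := 1 + \sum_(y <- Ns) f y.
have fb : {in Ns, forall y, f y <= b}.
  move=> y yN; apply: le_trans (le_sum_seq _ yN) _; last by rewrite lerDr.
  by move=> x /fN /ltW.
have b0 : 0 < b.
  by rewrite ltr_pwDl // big_seq sumr_ge0 // => y /fN /ltW.
(* The sum dominates each b / f y, whence f y / b >= 1 / L; the successor makes up for the
   truncation and keeps L positive. *)
pose L := (Num.truncn (\sum_(y <- Ns) b / f y)).+1.
have Lb : {in Ns, forall y, b / f y <= L%:R}.
  move=> y yN; apply: le_trans (le_sum_seq (f := fun y => b / f y) _ yN) _.
    by move=> x /fN fx; rewrite divr_ge0 ?ltW.
  by apply/ltW/truncnS_gt.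
have fs0 : fset0 \notin fs.
  by apply/negP => /fsE; rewrite /supp /= chi0 ltxx.
unshelve eexists (@DepthStructure R d fs Ns (fun x => f x / b) L _ _ _ _ _ _).
- by [].
- exact: undup_uniq.
- exact: fs0.
- exact: NsP.
- by move=> x y; rewrite fD mulrDl.
- move=> y yN; split; last by rewrite ler_pdivrMr // mul1r fb.
  have := Lb y yN; rewrite ler_pdivrMr ?fN // => H.
  by rewrite mulrAC ler_pdivlMr // mul1r mulrC.
rewrite /= (_ : [set` fs] = supp chi) ?supp_compl //.
by apply/seteqP; split => F /fsE.
Qed.

Variables (mu : R -> probability (bp_space d) R).
Hypothesis mu_law : forall q : R, 0 <= q <= 1 -> is_bp_law chi q (mu q).

(** This puts 1 into the set whose infimum is [q_c], so that the set is nonempty. *)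
Lemma not_infected_at_1 t : mu 1 (not_infected d t) = 0%E.
Proof.
have q1 : 0 <= (1 : R) <= 1 by rewrite ler01 lexx.
have : mu 1 [set om : bp_space d | (om 0).2 = false] = 0%E.
  have := mu_law q1 [fset 0]%fset (fun=> setT) (fun=> [set false]).
  rewrite big_seq_fset1 bernoulli_probE // !diracE !in_set1 /= /unstable.onem.
  rewrite subrr mul0e mule0 adde0 mule0 => <-; congr (mu 1 _).
  apply/seteqP; split => om /= H; last by have [] := H 0; rewrite ?inE.
  by move=> x; rewrite inE => /eqP ->.
apply: subset_measure0.
- by rewrite not_infectedE; apply: measurable_alive.
- exact: (measurable_site (0 : site d) [set v | v.2 = false]).
- by rewrite not_infectedE => om /= /alive_initial.
Qed.

Lemma subcritical_witness q : q_c mu < q ->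
  exists q0, [/\ 0 <= q0 <= 1, q0 < q &
    mu q0 (not_infected d t) @[t --> \oo] --> 0%E].
Proof.
move=> /inf_lt[|q0 [q01 Hq0] q0q]; last by exists q0.
exists 1; split; first by rewrite ler01 lexx.
by under eq_fun do rewrite not_infected_at_1; apply: cvg_cst.
Qed.

Lemma eventually_small q0 (e : R) : 0 < e ->
  mu q0 (not_infected d t) @[t --> \oo] --> 0%E ->
  exists t, (mu q0 (not_infected d t) < e%:E)%E.
Proof.
move=> e0 /fine_cvgP[_ /cvgr_lt /(_ e e0) [t _ /(_ t (leqnn t)) /= H]].
exists t; rewrite -(@fineK _ (mu q0 _)) ?lte_fin //.
by rewrite fin_num_measure // not_infectedE; apply: measurable_alive.
Qed.

(** A healthy site with the empty family never changes: if [chi] charged that family, the origin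
    would survive forever with positive probability. *)
Lemma empty_family_null q0 : 0 <= q0 < 1 ->
  mu q0 (not_infected d t) @[t --> \oo] --> 0%E -> chi [set fset0] = 0%E.
Proof.
move=> /andP[q00 q01] H; apply/eqP/negPn/negP => chi0.
have q0b : 0 <= q0 <= 1 by rewrite q00 ltW.
pose p := fine (chi [set fset0]).
have pE : chi [set fset0] = p%:E by rewrite fineK // fin_num_measure.
have p0 : 0 < p.
  by rewrite lt_neqAle fine_ge0 // andbT eq_sym -(inj_eq (@EFin_inj _)) -pE.
have [|t] := @eventually_small q0 (p * (1 - q0)) _ H.
  by rewrite mulr_gt0 // subr_gt0.
apply/negP; rewrite -leNgt.
pose Z := [set om : bp_space d | om 0 = (fset0, false)].
have <- : mu q0 Z = (p * (1 - q0))%:E.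
  have := mu_law q0b [fset 0]%fset (fun=> [set fset0]) (fun=> [set false]).
  rewrite big_seq_fset1 bernoulli_probE // !diracE !in_set1 /= /unstable.onem.
  rewrite mule0 add0e mule1 pE -EFinM => <-; congr (mu q0 _).
  apply/seteqP; split => om /= H0.
    by move=> x; rewrite inE => /eqP ->; rewrite H0.
  have := H0 0; rewrite inE eqxx => /(_ isT) [F0 u0].
  by rewrite /Z /= [om 0]surjective_pairing F0 u0.
rewrite le_measure ?inE //.
- exact: (measurable_site (0 : site d) [set v | v = (fset0, false)]).
- by rewrite not_infectedE; apply: measurable_alive.
- rewrite not_infectedE => om /= om0; rewrite alive_rec om0 /=.
  by apply/blockedP => X; rewrite inE.
Qed.

End Consequences.

Lemma reach_delta (R : realType) (d : nat) (D : depth_structure R d) k z :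
  {in reach D k z, forall x, delta D z <= delta D x}.
Proof.
elim: k z => [|k IH] z x; rewrite inE; first by move=> /eqP ->.
move=> /orP[/eqP -> //|/flattenP[r /mapP[y yN ->] /IH]]; rewrite deltaD.
by have := step_gt0 yN; lra.
Qed.

Lemma expr_le_expR (R : realType) (h : R) n :
  0 <= h <= 1 -> (1 - h) ^+ n <= expR (- (h * n%:R)).
Proof.
move=> /andP[h0 h1]; rewrite -mulNr mulrC expRM_natl.
rewrite lerXn2r ?nnegrE ?subr_ge0 ?expR_ge0 //.
exact: expR_ge1Dx.
Qed.

(** Rounding down loses at most one level, which the factor [expR h] pays for. *)
Lemma level_rate (R : realType) (h : R) (L t : nat) : (0 < L)%N -> 0 <= h ->
  expR (- (h * (t.+1 %/ L)%:R)) <= expR h * expR (- (h / L%:R * t%:R)).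
Proof.
move=> L0 h0; rewrite -expRD ler_expR.
have H : t%:R / L%:R <= (t.+1 %/ L)%:R + 1 :> R.
  rewrite ler_pdivrMr ?ltr0n // natr1 -natrM ler_nat.
  by rewrite ltnW // ltnW // ltn_ceil.
have := ler_wpM2l h0 H; rewrite mulrAC -mulrA; lra.
Qed.

Theorem theorem1p7 (R : realType) (d : nat) (d_ge1 : (1 <= d)%N)
  (chi : probability (update_family d) R)
  (chi_finite : finite_set (supp chi))
  (chi_half_space : in_common_half_space chi)
  (mu : R -> probability (bp_space d) R)
  (mu_law : forall q : R, 0 <= q <= 1 -> is_bp_law chi q (mu q)) :
  forall q : R, 0 <= q <= 1 -> q_c mu < q ->
  exists c C : R, 0 < c /\ 0 < C /\
    forall t : nat, (0 < t)%N ->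
      (mu q (not_infected d t) <= (C * expR (- (c * t%:R)))%:E)%E.
Proof.
move=> q q01 /(subcritical_witness mu_law)[q0 [q001 q0q q0_lim]].
have q0_lt1 : q0 < 1 by case/andP: q01 => _; apply: lt_le_trans.
have chi0 : chi [set fset0] = 0%E.
  by apply: (empty_family_null mu_law _ q0_lim); lra.
have [D D_fams] := depth_structure_exists chi_finite chi_half_space chi0.
(* M solves (1 - M) (1 - q0) = 1 - q. *)
pose M := (q - q0) / (1 - q0); pose N := (size (steps D))%:R : R.
have N0 : 0 <= N by rewrite ler0n.
have M0 : 0 < M by rewrite divr_gt0 // subr_gt0.
have M1 : M <= 1 by rewrite ler_pdivrMr; lra.
(* Then N e + e = M / 2, so that h <= e / 2 ensures h + N e <= M; also e <= 1 / 2. *)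
pose e := M / (2 * (N + 1)).
have eE : e * N + e = M / 2 by rewrite /e; field; lra.
have e0 : 0 < e by rewrite divr_gt0 //; lra.
have eN0 : 0 <= e * N by rewrite mulr_ge0 // ltW.
have [t0 theta_lt] := eventually_small (e := e / 2) ltac:(lra) q0_lim.
(* The successor is the time shift of [alive]. The bound e is shared equally: e / 2 for survival up
   to m, and (m + 1) h = e / 2 for the green levels. *)
pose m := t0.+1; pose h := e / (2 * m.+1%:R).
have m0 : 0 < m.+1%:R :> R by rewrite ltr0n.
have hE : m.+1%:R * h = e / 2 by rewrite /h; field; rewrite gt_eqF.
have h0 : 0 < h by rewrite divr_gt0 // mulr_gt0.
have he : h <= e / 2 by rewrite -hE ler_peMl ?ler1n // ltW.
have h01 : 0 <= h <= 1 by lra.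
pose L := speed D; have L0 := speed_gt0 D.
(* The factor 2 bounds 1 / (1 - e), and [expR h] comes from rounding in [level_rate]. *)
exists (h / L%:R), (2 * expR h); split; first by rewrite divr_gt0 ?ltr0n.
split; first by rewrite mulr_gt0 ?expR_gt0.
move=> t _; rewrite not_infectedE.
(* The window holds every site on which survival of the origin depends, so its survival probability
   is exact; sorting by depth is what [run_site] demands. *)
pose V := sort (fun x y => delta D x <= delta D y) (undup (reach D t.+1 0)).
have memV x : (x \in V) = (x \in reach D t.+1 0) by rewrite mem_sort mem_undup.
have uV : uniq V by rewrite sort_uniq undup_uniq.
have sV : pairwise (fun x y => delta D x <= delta D y) V.
  rewrite -sorted_pairwise => [|y x z]; last exact: le_trans.
  by apply: sort_sorted => x y; apply: le_total.
rewrite -(survival_reach D_fams q01 (mu_law q q01) h uV); last first.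
  by move=> x; rewrite memV.
rewrite lee_fin; set S := survival _ _ _ _ _ _ _.
have : S * (1 - e) <= (1 - h) ^+ (t.+1 %/ L).
  apply: (survival_decay (mass_ge0 chi) (mass_sum D_fams) (m := m) (q0 := q0)
    (M := M)) => //.
  - by move=> x; rewrite memV => /reach_delta; rewrite delta0.
  - move=> V' z uV'; rewrite hE -lee_fin.
    apply: le_trans (survival_le D_fams q001 (mu_law q0 q001) _ _ _ uV') _.
    rewrite (alive_invariant D_fams q001 (mu_law q0 q001)) -not_infectedE.
    by apply: le_trans (ltW theta_lt) _; rewrite lee_fin; lra.
  - by rewrite -/N mulrC; lra.
  - by rewrite /M mulrBl divfK ?mul1r; lra.
  - exact: leq_trunc_div.
have := le_trans (expr_le_expR (t.+1 %/ L) h01) (level_rate t L0 (ltW h0)).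
have S0 : 0 <= S.
  apply: Ex_ge0 => //.
  by apply: weight_law => //; [apply: mass_ge0|apply: mass_sum].
have e12 : e <= 1 / 2 by lra.
set X := (1 - h) ^+ _; set Y := expR h * _ => XY SX.
have : S * (1 / 2) <= S * (1 - e) by rewrite ler_wpM2l //; lra.
by rewrite -mulrA -/Y; lra.
Qed.
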